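(* Let $f:\mathbb{R}^d\to\mathbb{R}$ be a function with Fourier transform $\check{f}:\mathbb{R}^d\to\mathbb{C}$, in the sense that $f(x)=\int_{\mathbb{R}^d}e^{i\langle\omega,x\rangle}\check{f}(\omega)\,d\omega$. Then for all $x\in\mathbb{R}^d$ such that \[ \int_{\mathbb{R}^d}\min\left\{2|\langle\omega,x\rangle|,\ |\langle\omega,x\rangle|^2/2\right\}|\check{f}(\omega)|\,d\omega<\infty, \] we have \[ f(x)=f(0)+f'(0)[x]-\int_{\mathbb{R}^d}\int_0^\infty \mathbb{E}_{\varepsilon}\left[(\varepsilon\langle\omega,x\rangle-u)_+\cos(u+\varepsilon b(\omega))\right]|\check{f}(\omega)|\,du\,d\omega, \] where $b(\cdot)$ is defined via $\check{f}(\omega)=|\check{f}(\omega)|e^{ib(\omega)}$ and $\mathbb{E}_{\varepsilon}[g(\varepsilon,u,\omega)]=(g(1,u,\omega)+g(-1,u,\omega))/2$ for any function $g$. Moreover, if for any two random variables $W,W_n\in\mathbb{R}^d$ with $\mathbb{E}[W]=\mathbb{E}[W_n]=0$, \[ \int_{\mathbb{R}^d}\mathbb{E}\left[\min\{2|\langle\omega,W_n\rangle|,|\langle\omega,W_n\rangle|^2/2\}\right]|\check{f}(\omega)|\,d\omega<\infty,\qquad \int_{\mathbb{R}^d}\mathbb{E}\left[\min\{2|\langle\omega,W\rangle|,|\langle\omega,W\rangle|^2/2\}\right]|\check{f}(\omega)|\,d\omega<\infty, \] then \[ \Delta_f(W,W_n)=\left|\int_{\mathbb{R}^d}\int_0^\infty\mathbb{E}_{\varepsilon}\left[\mathbb{E}\left\{(\varepsilon\langle\omega,W_n\rangle-u)_+-(\varepsilon\langle\omega,W\rangle-u)_+\right\}\cos(u+\varepsilon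 b(\omega))\right]|\check{f}(\omega)|\,du\,d\omega\right| \] and \[ \Delta_f(W,W_n)\le\mathbb{E}_{\varepsilon}\left[\int_{\mathbb{R}^d}\int_0^\infty\left|\mathbb{E}\left[(\varepsilon\langle\omega,W_n\rangle-u)_+-(\varepsilon\langle\omega,W\rangle-u)_+\right]\right||\check{f}(\omega)|\,du\,d\omega\right]. \]
   Context: $\langle\cdot,\cdot\rangle$ is the Euclidean inner product on $\mathbb{R}^d$ and $(t)_+=\max\{t,0\}$. For random variables $W_n,W$ in $\mathbb{R}^d$, $\Delta_f(W,W_n)=\Delta_f(W_n,W):=|\mathbb{E}[f(W_n)]-\mathbb{E}[f(W)]|$. The directional derivative of $f$ at $0$ in the direction $x$ is $f'(0)[x]=\frac{d}{dt}f(tx)\big|_{t=0}$. The operator $\mathbb{E}_{\varepsilon}$ averages over the two values $\varepsilon=1$ and $\varepsilon=-1$, while $\mathbb{E}$ is expectation over $W_n$ and $W$.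
   Formalization: With E_ε the average over ε=±1, the three displayed formulas are off by a factor 2 (e.g. d=1, f(x)=exp(-x²/2)); each right-hand integral is multiplied by 2. In the Δ_f identity the u-integral is read as an improper integral. *)

(* Defs.v *)
From HB Require Import structures.
From mathcomp Require Import all_boot all_order all_algebra.
From mathcomp Require Import all_classical all_reals all_analysis.
From mathcomp Require Import complex.

Set Implicit Arguments.
Unset Strict Implicit.
Unset Printing Implicit Defensive.

Import Order.TTheory GRing.Theory Num.Theory.
Import numFieldNormedType.Exports.
Import ComplexField.

Local Open Scope classical_set_scope.
Local Open Scope complex_scope.
Local Open Scope ring_scope.

Definition rV_display : measure_display.
Proof. exact: default_measure_display. Qed.

(* The sigma-algebra generated by the coordinates, i.e. the Borel one. *)
Section measurable_rV.
Context (R : realType) (n : nat).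

Definition rV_coord (i : 'I_n) (v : 'rV[R]_n) : R := v ord0 i.

Let rV_set0 : g_sigma_preimage rV_coord set0.
Proof. exact: sigma_algebra0. Qed.

Let rV_setC A : g_sigma_preimage rV_coord A -> g_sigma_preimage rV_coord (~` A).
Proof. exact: sigma_algebraC. Qed.

Let rV_bigcup (F : _^nat) : (forall i, g_sigma_preimage rV_coord (F i)) ->
  g_sigma_preimage rV_coord (\bigcup_i (F i)).
Proof. exact: sigma_algebra_bigcup. Qed.

HB.instance Definition _ := @isMeasurable.Build rV_display
  'rV[R]_n (g_sigma_preimage rV_coord) rV_set0 rV_setC rV_bigcup.

Lemma measurable_rV_coord (i : 'I_n) : measurable_fun [set: 'rV[R]_n] (rV_coord i).
Proof.
move=> _ Y mY; rewrite setTI; apply: sub_sigma_algebra => /=.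
rewrite -bigcup_seq/=; exists i => /=; first by rewrite mem_index_enum.
by exists Y => //; rewrite setTI.
Qed.

Lemma measurable_fun_rV d (T : measurableType d) (f : T -> 'rV[R]_n) :
  (forall i, measurable_fun [set: T] (fun t => f t ord0 i)) ->
  measurable_fun [set: T] f.
Proof.
move=> mf _ A mA; rewrite setTI.
have [sf sub] : sigma_algebra setT (image_set_system [set: T] f measurable) /\
  \big[setU/set0]_(i < n) preimage_set_system setT (rV_coord i) measurable
    `<=` image_set_system [set: T] f measurable.
  split; first exact/sigma_algebra_image/sigma_algebra_measurable.
  move=> B; rewrite -bigcup_seq => -[i _ [C mC <-]].
  rewrite /image_set_system /= !setTI.
  by rewrite -[X in measurable X]setTI; exact: mf.
have := mA _ (conj sf sub).
by rewrite /image_set_system /= setTI.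
Qed.

End measurable_rV.

Section lebesgue_rV.
Context (R : realType).

Section step.
Variable n : nat.
Variable m : {sigma_finite_measure set 'rV[R]_n -> \bar R}.
Local Open Scope ereal_scope.

Definition rV_cons (p : measurableTypeR R * 'rV[R]_n) : 'rV[R]_n.+1 :=
  row_mx (p.1)%:M p.2.

Lemma measurable_rV_cons : measurable_fun setT rV_cons.
Proof.
apply: measurable_fun_rV => i; case: (@split_ordP 1 n i) => j ->.
  rewrite [X in measurable_fun _ X](_ : _ = fst)//.
  apply/funext => p; apply: etrans (row_mxEl (p.1)%:M p.2 ord0 j) _.
  by rewrite mxE (ord1 j) eqxx mulr1n.
rewrite [X in measurable_fun _ X](_ : _ = rV_coord j \o snd); last first.
  by apply/funext => p; exact: (row_mxEr (p.1)%:M p.2 ord0 j).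
by apply: measurableT_comp => //; exact: measurable_rV_coord.
Qed.

Definition rV_cons_measure (A : set 'rV[R]_n.+1) : \bar R :=
  (lebesgue_measure \x m) (rV_cons @^-1` A).

Let cons_measurable A : measurable A -> measurable (rV_cons @^-1` A).
Proof.
by move=> mA; rewrite -[X in measurable X]setTI; exact: measurable_rV_cons.
Qed.

Let cons0 : rV_cons_measure set0 = 0.
Proof. by rewrite /rV_cons_measure preimage_set0 measure0. Qed.

Let cons_ge0 A : 0 <= rV_cons_measure A.
Proof. exact: measure_ge0. Qed.

Let cons_sigma_additive : semi_sigma_additive rV_cons_measure.
Proof.
move=> F mF tF mUF; rewrite /rV_cons_measure preimage_bigcup.
apply: measure_semi_sigma_additive.
- by move=> k; exact: cons_measurable.
- apply/trivIsetP => /= i j _ _ ij; rewrite -preimage_setI.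
  by move/trivIsetP : tF => /(_ _ _ _ _ ij) ->//; rewrite preimage_set0.
- by rewrite -preimage_bigcup; exact: cons_measurable.
Qed.

HB.instance Definition _ := isMeasure.Build _ _ _ rV_cons_measure
  cons0 cons_ge0 cons_sigma_additive.

Definition rV_uncons (w : 'rV[R]_n.+1) : measurableTypeR R * 'rV[R]_n :=
  (w ord0 ord0, @rsubmx R 1 1 n w).

Let uncons_measurable A : measurable A -> measurable (rV_uncons @^-1` A).
Proof.
move=> mA; rewrite -[X in measurable X]setTI.
suff : measurable_fun setT rV_uncons by exact.
apply/measurable_fun_pair => /=; first exact: (measurable_rV_coord ord0).
apply: measurable_fun_rV => i.
rewrite [X in measurable_fun _ X](_ : _ = @rV_coord R n.+1 (rshift 1 i)).
  exact: measurable_rV_coord.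
by apply/funext => w; rewrite mxE.
Qed.

Let rV_consK : cancel rV_cons rV_uncons.
Proof.
case=> x v; rewrite /rV_uncons /rV_cons row_mxKr; congr pair.
rewrite (_ : ord0 = lshift n (ord0 : 'I_1)); last exact/val_inj.
by apply: etrans (row_mxEl x%:M v ord0 ord0) _; rewrite mxE eqxx mulr1n.
Qed.

Let cons_sigma_finite : sigma_finite setT rV_cons_measure.
Proof.
have /sigma_finiteP[F [TF ndF Foo]] := sigma_finiteT (@lebesgue_measure R).
have /sigma_finiteP[G [TG ndG Goo]] := sigma_finiteT m.
exists (fun k => rV_uncons @^-1` (F k `*` G k)).
  rewrite -preimage_bigcup (_ : \bigcup_k _ = setT) ?preimage_setT//.
  apply/seteqP; split=> // -[x v] _.
  have [k _ Fkx] : (\bigcup_k F k) x by rewrite -TF.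
  have [l _ Glv] : (\bigcup_k G k) v by rewrite -TG.
  exists (maxn k l) => //; split => /=.
    by move: x Fkx; exact/subsetPset/ndF/leq_maxl.
  by move: v Glv; exact/subsetPset/ndG/leq_maxr.
move=> k; have [mF Fkoo] := Foo k; have [mG Gkoo] := Goo k.
split; first by apply: uncons_measurable; exact: measurableX.
rewrite /rV_cons_measure -comp_preimage.
rewrite (_ : rV_uncons \o rV_cons = id); last first.
  by apply/funext => p /=; rewrite rV_consK.
by rewrite preimage_id product_measure1E// lte_mul_pinfty// ge0_fin_numE.
Qed.

HB.instance Definition _ := @Measure_isSigmaFinite.Build _ _ _
  rV_cons_measure cons_sigma_finite.

End step.

Definition rV0_measure : {sigma_finite_measure set 'rV[R]_0 -> \bar R} :=
  \d_(0 : 'rV[R]_0).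

(* Image of lebesgue_measure \x ... \x lebesgue_measure; see lebesgue_rV_box. *)
Fixpoint lebesgue_rV n : {sigma_finite_measure set 'rV[R]_n -> \bar R} :=
  match n with
  | 0 => rV0_measure
  | k.+1 => rV_cons_measure (lebesgue_rV k)
  end.

End lebesgue_rV.

Lemma lebesgue_rV_box (R : realType) n (A : 'I_n -> set (measurableTypeR R)) :
  (forall i, measurable (A i)) ->
  lebesgue_rV R n [set v | forall i, A i (v ord0 i)] =
  (\prod_(i < n) lebesgue_measure (A i))%E.
Proof.
elim: n A => [|n IH] A mA /=.
  rewrite big_ord0 /dirac indicE mem_set//.
  by case.
pose B : set 'rV[R]_n := [set v | forall i, A (lift ord0 i) (v ord0 i)].
have mB : measurable B.
  rewrite (_ : B =
    \bigcap_(i in [set: 'I_n]) (@rV_coord R n i @^-1` A (lift ord0 i))).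
    apply: fin_bigcap_measurable => // i _.
    by rewrite -[X in measurable X]setTI; apply: measurable_rV_coord => //; exact: mA.
  by apply/seteqP; split=> v /= h i => [_|]; exact: h.
have := IH (fun i => A (lift ord0 i)) (fun i => mA (lift ord0 i)).
rewrite big_ord_recl => <-.
rewrite -[X in _ = (_ * lebesgue_rV R n X)%E]/B.
rewrite -(product_measure1E lebesgue_measure (lebesgue_rV R n) (mA ord0) mB).
rewrite /rV_cons_measure; congr product_measure1.
have cons0 (p : measurableTypeR R * 'rV[R]_n) : rV_cons p ord0 ord0 = p.1.
  rewrite (_ : ord0 = lshift n (ord0 : 'I_1)); last exact/val_inj.
  by apply: etrans (row_mxEl (p.1)%:M p.2 ord0 ord0) _; rewrite mxE eqxx mulr1n.
have consS (p : measurableTypeR R * 'rV[R]_n) j :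
    rV_cons p ord0 (lift ord0 j) = p.2 ord0 j.
  rewrite (_ : lift ord0 j = rshift 1 j); last exact/val_inj.
  exact: (row_mxEr (p.1)%:M p.2 ord0 j).
apply/seteqP; split=> p /=.
  move=> h; split; first by have := h ord0; rewrite cons0.
  by move=> j; have := h (lift ord0 j); rewrite consS.
move=> [h0 h] i; case: (unliftP ord0 i) => [j ->|->].
  by rewrite consS.
by rewrite cons0.
Qed.

Section defs.
Context (R : realType).

Definition inner (n : nat) (u v : 'rV[R]_n) : R :=
  \sum_(i < n) u ord0 i * v ord0 i.

Definition pos_part (t : R) : R := Num.max t 0.

Definition expi (t : R) : R[i] := cos t +i* sin t.

Section complex_integral.
Context d (T : measurableType d) (mu : {measure set T -> \bar R}).

Definition complex_integrable (g : T -> R[i]) : Prop :=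
  mu.-integrable setT (fun w => (complex.Re (g w))%:E) /\
  mu.-integrable setT (fun w => (complex.Im (g w))%:E).

Definition complex_integral (g : T -> R[i]) : R[i] :=
  (\int[mu]_w complex.Re (g w)) +i* (\int[mu]_w complex.Im (g w)).

End complex_integral.

(* The Fourier integral is a Lebesgue integral over all of R^n. As the
   exponential has modulus 1, it makes sense exactly when fhat is integrable. *)
Definition fourier_repr (n : nat) (f : 'rV[R]_n -> R) (fhat : 'rV[R]_n -> R[i])
    : Prop :=
  complex_integrable (lebesgue_rV R n) fhat /\
  forall x, (f x)%:C =
    complex_integral (lebesgue_rV R n) (fun w => expi (inner w x) * fhat w).

Definition taylor_bound (t : R) : R := Num.min (2 * `|t|) (`|t| ^+ 2 / 2).

(* From exp(it) - 1 - it =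
     - \sum_(e = 1, -1) \int_(u >= 0) pos_part (e t - u) exp(i e u) du
   the remainder of a first-order expansion carries the sum over both signs,
   that is, 2 * sign_avg. *)
Definition sign_avg (g : R -> R) : R := (g 1 + g (-1)) / 2.

Definition sign_avge (g : R -> \bar R) : \bar R :=
  ((g 1%R + g (-1)%R) * (2^-1)%:E)%E.

(* Improper integral over [0, +oo[: under a first-moment assumption on W,
   u |-> E[(<w, W> - u)_+] decreases to 0 but need not be integrable, and its
   product with cos (u + c) is then only conditionally integrable. *)
Definition partial_integral (g : R -> R) (a : R) : R :=
  \int[lebesgue_measure]_(u in `[0, a]) g u.

Definition improper_integral (g : R -> R) : R :=
  lim (partial_integral g a @[a --> +oo]).

Section random_vectors.
Context d (Omega : measurableType d) (P : probability Omega R) (n : nat).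
Implicit Types V W : Omega -> 'rV[R]_n.

Definition centered V : Prop := forall i,
  P.-integrable setT (fun s => (V s ord0 i)%:E) /\
  ('E_P[fun s => V s ord0 i] = 0)%E.

Definition ridge_gap V W (w : 'rV[R]_n) (e u : R) : R :=
  fine ('E_P[fun s => pos_part (e * inner w (V s) - u) -
                      pos_part (e * inner w (W s) - u)]).

Definition Delta (f : 'rV[R]_n -> R) V W : R :=
  `| fine ('E_P[f \o V]) - fine ('E_P[f \o W]) |.

End random_vectors.
End defs.

(* Main.v *)
(**
Integrating by parts, [\int_(0 <= u <= a) (X - u)_+ cos (u + c) du] has a closed
form, bounded by [2 |X| + 2]. Summed over the pairs [(X, c) = (t, b)] and
[(-t, -b)] it is, as soon as [|t| <= a], the real part
[cos b - cos (t + b) - t sin b] of [e^(ib) (1 + it - e^(it))].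

At a fixed [x], take [t = <w, x>], multiply by [|fhat w|] and integrate over [w]:
the three terms give [f 0], [f x] and the derivative of [t |-> f (t x)] at [0], by
differentiation under the integral sign. The last term is integrable because
[|t| <= 4 + min (2 |t|, t^2 / 2)] and [fhat] is integrable.

For random vectors, Fubini turns the partial integral of the mean stop-loss
transform into the mean of the closed form, and dominated convergence gives the
improper integral. As the vectors are centered the linear term disappears, so the
improper integral is half the difference of the means of
[Re (fhat w e^(i <w, W>))] and [Re (fhat w e^(i <w, Wn>))], whose integral over
[w] is the difference of expectations of [f] by Fubini. The upper bound holds for
every partial integral, hence in the limit.
*)
Require Import Defs.
From HB Require Import structures.
From mathcomp Require Import all_boot all_order all_algebra.
From mathcomp Require Import all_classical all_reals all_analysis.
From mathcomp Require Import complex.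
From mathcomp Require Import measurable_realfun ring lra.

Set Implicit Arguments.
Unset Strict Implicit.
Unset Printing Implicit Defensive.

Import Order.TTheory GRing.Theory Num.Theory.
Import numFieldNormedType.Exports.

Local Open Scope classical_set_scope.
Local Open Scope complex_scope.
Local Open Scope ring_scope.

Lemma norm_cos_le1 (R : realType) (t : R) : `|cos t| <= 1.
Proof. by rewrite ler_norml cos_geN1 cos_le1. Qed.

Lemma norm_sin_le1 (R : realType) (t : R) : `|sin t| <= 1.
Proof. by rewrite ler_norml sin_geN1 sin_le1. Qed.

(** * Integrals of a positive part against a cosine *)

Section stop_loss.
Context {R : realType}.
Implicit Types a X c u : R.

Definition stop_loss_primitive X c u : R := (X - u) * sin (u + c) - cos (u + c).

(** The [sin (u + c)] coming from [- cos (u + c)] cancels the one left by differentiating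
    [X - u]. *)
Lemma is_derive_stop_loss_primitive X c u :
  is_derive u 1 (stop_loss_primitive X c) ((X - u) * cos (u + c)).
Proof.
rewrite /stop_loss_primitive; apply: is_derive_eq.
rewrite /GRing.scale/=. 
ring.
Qed.

Lemma stop_loss_continuous X c : continuous (fun u => (X - u) * cos (u + c)).
Proof.
move=> u; apply: cvgM.
  by apply: cvgB; [exact: cvg_cst|exact: cvg_id].
apply: continuous_comp; last exact: continuous_cos.
by apply: cvgD; [exact: cvg_id|exact: cvg_cst].
Qed.

(** For [0 <= a] the upper endpoint is [X] clamped to [[0, a]], since the positive part of [X - u]
    vanishes for [u] past [X]. *)
Definition stop_loss a X c : R :=
  stop_loss_primitive X c (Num.min a (Num.max X 0)) - stop_loss_primitive X c 0.

(** The fundamental theorem of calculus is applied on [[0, min a X]]. It asks for a nondegenerate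
    interval, whence the separate cases [X <= 0] and [a = 0]. *)
Lemma Rintegral_pos_part_cos a X c : 0 <= a ->
  \int[lebesgue_measure]_(u in `[0, a]) (pos_part (X - u) * cos (u + c)) =
  stop_loss a X c.
Proof.
move=> a0; rewrite /stop_loss; have [X0|X0] := leP X 0.
  rewrite (min_r a0) subrr.
  (* Writing 0 as an integral over the empty set turns both sides into integrals of restrictions,
     which are compared pointwise. *)
  rewrite -[RHS](@Rintegral_set0 _ _ _ lebesgue_measure (fun=> 0 : R)).
  rewrite Rintegral_mkcond [RHS]Rintegral_mkcond; congr Rintegral.
  apply/funext => u; rewrite !patchE in_set0; case: ifPn => // /set_mem/=.
  rewrite in_itv/= => /andP[u0 _].
  by rewrite /pos_part max_r ?mul0r// subr_le0 (le_trans X0).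
have [a00|a_gt0] := eqVneq a 0.
  by rewrite a00 set_itv1 Rintegral_set1 min_l ?subrr// ltW.
have {a_gt0}a_gt0 : 0 < a by rewrite lt_neqAle eq_sym a_gt0.
set m := Num.min a X.
have m0 : 0 < m by rewrite /m lt_min a_gt0.
have dF u := is_derive_stop_loss_primitive X c u.
have -> : \int[lebesgue_measure]_(u in `[0, a])
      (pos_part (X - u) * cos (u + c)) =
    \int[lebesgue_measure]_(u in `[0, m]) ((X - u) * cos (u + c)).
  rewrite Rintegral_mkcond [RHS]Rintegral_mkcond; congr Rintegral.
  apply/funext => u; rewrite !patchE !mem_setE !in_itv/= /m le_min /pos_part.
  have [u0|] //= := leP 0 u; have [ua|] //= := leP u a.
  by have [uX|uX] := leP u X; [rewrite max_l// subr_ge0|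
    rewrite max_r ?mul0r// subr_le0 ltW].
rewrite /Rintegral (@continuous_FTC2 _ _ (stop_loss_primitive X c))//.
- exact/continuous_subspaceT/stop_loss_continuous.
- have cF u : {for u, continuous (stop_loss_primitive X c)}.
    exact/differentiable_continuous/derivable1_diffP/ex_derive.
  split.
  + by move=> u _; exact: ex_derive.
  + exact/cvg_at_right_filter/cF.
  + exact/cvg_at_left_filter/cF.
- by move=> u _; rewrite derive1E derive_val.
Qed.

(* Uniform in [a] and integrable in [X]: this is the domination that lets the
   cutoff [a] tend to infinity under an expectation. *)
Lemma stop_loss_bound a X c : 0 <= a -> `|stop_loss a X c| <= 2 * `|X| + 2.
Proof.
move=> a0; rewrite /stop_loss /stop_loss_primitive.
set m := Num.min a _; rewrite add0r subr0.
(* The endpoint [m] is 0 when [X <= 0] and lies in [[0, X]] otherwise. *)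
have mX : `|X - m| <= `|X|.
  rewrite /m; have [X0|X0] := leP X 0; first by rewrite min_r// subr0.
  have ? : 0 <= Num.min a X by rewrite le_min a0 ltW.
  have ? : Num.min a X <= X by rewrite ge_min lexx orbT.
  by rewrite ger0_norm ?subr_ge0// (gtr0_norm X0) gerBl.
have s (t y : R) : `|y * sin t| <= `|y|.
  by rewrite normrM ler_piMr// norm_sin_le1.
have := s (m + c) (X - m); have := s c X.
have := norm_cos_le1 c; have := norm_cos_le1 (m + c).
move: (_ * _) (X * sin c) (cos _) (cos _) => p q r t.
move: `|X - m| `|X| mX => y x yx; rewrite !ler_norml =>
  /andP[? ?] /andP[? ?] /andP[? ?] /andP[? ?].
by apply/andP; split; lra.
Qed.

(** Only one of the two signs contributes: its endpoint is [|t|], not cut by [a], while the endpoint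
    of the other sign is 0. By parity of sine and cosine both cases give the same expression, free
    of [a]. *)
Lemma stop_loss_sum a t c : `|t| <= a ->
  stop_loss a t c + stop_loss a (- t) (- c) = cos c - cos (t + c) - t * sin c.
Proof.
rewrite ler_norml => /andP[ta ta'].
rewrite /stop_loss /stop_loss_primitive !add0r !subr0 !sinN !cosN.
have [t0|t0] := leP t 0.
  rewrite (max_l (x := - t)) ?oppr_ge0// (min_r (x := a) (y := - t)); last lra.
  rewrite min_r; last lra.
  have -> : cos (- t - c) = cos (t + c) by rewrite -opprD cosN.
  by rewrite add0r subrr; lra.
rewrite (max_r (x := - t)) ?oppr_le0 ?(ltW t0)// (min_r (x := a) (y := 0)); last lra.
by rewrite min_r// subrr add0r cosN sinN; lra.
Qed.

End stop_loss.

(** * Domination, product measures and measurability *)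

Section integral_extras.
Context {R : realType}.

Lemma le_integrableR d (T : measurableType d) (mu : {measure set T -> \bar R})
    (D : set T) (f g : T -> R) : measurable D -> measurable_fun D f ->
  (forall x, D x -> `|f x| <= g x) -> mu.-integrable D (EFin \o g) ->
  mu.-integrable D (EFin \o f).
Proof.
move=> mD mf fg ig; apply: (le_integrable mD _ _ ig).
  exact/measurable_EFinP.
by move=> x Dx /=; rewrite lee_fin (le_trans (fg x Dx))// ler_norm.
Qed.

Lemma dominated_Rintegral_cvg d (T : measurableType d)
    (mu : {measure set T -> \bar R}) (f_ : (T -> R)^nat) (f g : T -> R) :
  (forall n, measurable_fun setT (f_ n)) -> measurable_fun setT f ->
  (forall x, f_ ^~ x @ \oo --> f x) -> mu.-integrable setT (EFin \o g) ->
  (forall n x, `|f_ n x| <= g x) ->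
  (\int[mu]_x f_ n x) @[n --> \oo] --> \int[mu]_x f x.
Proof.
move=> mf_ mf f_f ig f_g.
have mEf_ n : measurable_fun setT (EFin \o f_ n) by exact/measurable_EFinP.
have mEf : measurable_fun setT (EFin \o f) by exact/measurable_EFinP.
have [||if_ _ cf] := dominated_convergence measurableT mEf_ mEf _ ig.
- by apply: aeW => x _; apply: cvg_EFin; [exact: nearW|exact: f_f].
- by apply: aeW => x n _ /=; rewrite lee_fin.
apply: fine_cvg; rewrite fineK//; exact: integrable_fin_num.
Qed.

(** By Tonelli the integral of the absolute value is a product of two finite integrals. Such
    products are the dominating functions in the applications of Fubini below. *)
Lemma integrable_prodM d1 d2 (T1 : measurableType d1) (T2 : measurableType d2)
    (m1 : {sigma_finite_measure set T1 -> \bar R})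
    (m2 : {sigma_finite_measure set T2 -> \bar R}) (g : T1 -> R) (h : T2 -> R) :
  m1.-integrable setT (EFin \o g) -> m2.-integrable setT (EFin \o h) ->
  (m1 \x m2)%E.-integrable setT (fun z => (g z.1 * h z.2)%:E).
Proof.
move=> ig ih.
have mg : measurable_fun setT g by exact/measurable_EFinP/(measurable_int m1).
have mh : measurable_fun setT h by exact/measurable_EFinP/(measurable_int m2).
apply/integrable12ltyP.
  by apply/measurable_EFinP/measurable_funM; apply: measurableT_comp.
rewrite (eq_integral (fun x => `|(g x)%:E| * \int[m2]_y `|(h y)%:E|))%E.
  move/integrableP : ih => [_ ih].
  rewrite ge0_integralZr//.
  - rewrite lte_mul_pinfty//; first exact: integral_ge0.
      rewrite ge0_fin_numE; [by case/integrableP : ig|exact: integral_ge0].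
  - by apply: measurableT_comp => //; exact/measurable_EFinP.
  - exact: integral_ge0.
move=> x _; rewrite -ge0_integralZl//.
  by apply: eq_integral => y _; rewrite EFinM abseM.
by apply: measurableT_comp => //; exact/measurable_EFinP.
Qed.

(** Tonelli gives the measurability for the positive and the negative part, and the integral is the
    difference of theirs. *)
Lemma measurable_fun_integral2 d1 d2 (T1 : measurableType d1)
    (T2 : measurableType d2) (m2 : {sigma_finite_measure set T2 -> \bar R})
    (f : T1 * T2 -> \bar R) : measurable_fun setT f ->
  measurable_fun setT (fun x => \int[m2]_y f (x, y))%E.
Proof.
move=> mf; under eq_fun do rewrite integralE.
apply: emeasurable_funB.
- rewrite [X in measurable_fun _ X](_ : _ = fubini_F m2 f^\+%E).
    apply: measurable_fun_fubini_tonelli_F => //; exact: measurable_funepos.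
  by apply/funext => x; apply: eq_integral => y _; rewrite funepos_comp.
- rewrite [X in measurable_fun _ X](_ : _ = fubini_F m2 f^\-%E).
    apply: measurable_fun_fubini_tonelli_F => //; exact: measurable_funeneg.
  by apply/funext => x; apply: eq_integral => y _; rewrite funeneg_comp.
Qed.

Lemma measurable_pos_part : measurable_fun setT (@pos_part R).
Proof.
by apply: (measurable_maxr (f := id) (g := cst 0));
  [exact: measurable_id|exact: measurable_cst].
Qed.

Lemma measurable_sin : measurable_fun setT (@sin R).
Proof. apply: continuous_measurable_fun; exact: continuous_sin. Qed.

Lemma measurable_cos : measurable_fun setT (@cos R).
Proof. apply: continuous_measurable_fun; exact: continuous_cos. Qed.

End integral_extras.

Lemma pos_part_le_norm (R : realType) (x : R) : `|pos_part x| <= `|x|.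
Proof.
rewrite /pos_part; have [x0|x0] := leP x 0; first by rewrite normr0.
by rewrite lexx.
Qed.

Lemma pos_part_sub_le (R : realType) (x u : R) :
  0 <= u -> `|pos_part (x - u)| <= `|x|.
Proof.
move=> u0; rewrite /pos_part; have [x0|x0] := leP (x - u) 0; first by rewrite normr0.
by rewrite !gtr0_norm//; lra.
Qed.

Lemma integrable_pos_part_cos (R : realType) (a X c : R) :
  lebesgue_measure.-integrable `[0, a]
    (EFin \o (fun u => pos_part (X - u) * cos (u + c))).
Proof.
have iX : lebesgue_measure.-integrable `[0, a]
    (EFin \o (fun u : R => `|X| * \1_`[0, a] u)).
  apply: (integrableS measurableT) => //.
  exact: (integrableZl measurableT `|X| (integrable_indic_itv 0 a true false)).
apply: (le_integrableR _ _ _ iX) => //.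
- apply: measurable_funTS; apply: measurable_funM.
    by apply: measurableT_comp; [exact: measurable_pos_part|exact: measurable_funB].
  by apply: measurableT_comp; [exact: measurable_cos|exact: measurable_funD].
- move=> u au; rewrite indicE mem_set// mulr1 normrM -[leRHS]mulr1.
  move: au; rewrite /= in_itv/= => /andP[u0 _].
  rewrite ler_pM//; first exact: pos_part_sub_le.
  exact: norm_cos_le1.
Qed.

(** * The mean stop-loss transform of a random variable *)

Section mean_stop_loss.
Context {R : realType} d (Omega : measurableType d) (P : probability Omega R).
Variable X : Omega -> R.
Hypothesis iX : P.-integrable setT (EFin \o X).

Let mX : measurable_fun setT X.
Proof. exact/measurable_EFinP/(measurable_int P). Qed.

Lemma integrable_pos_part_sub (u : R) :
  P.-integrable setT (EFin \o (fun s => pos_part (X s - u))).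
Proof.
apply: (@le_integrableR _ _ _ _ _ _ (fun s => `|X s| + `|u|)) => //.
- apply: measurableT_comp; first exact: measurable_pos_part.
  exact: measurable_funB.
- by move=> s _; rewrite (le_trans (pos_part_le_norm _))// ler_normB.
- have := integrableD measurableT (integrable_norm iX)
    (finite_measure_integrable_cst P `|u| measurableT).
  exact.
Qed.

Definition mean_pos_part (u : R) : R := \int[P]_s pos_part (X s - u).

(** The indicator carries the restriction to [[0, a]], so that Fubini can be used on the whole
    product space. *)
Let f (a c : R) (z : measurableTypeR R * Omega) : R :=
  \1_`[0, a] z.1 * (pos_part (X z.2 - z.1) * cos (z.1 + c)).

Let mf a c : measurable_fun setT (f a c).
Proof.
apply: measurable_funM.
  by apply: measurableT_comp => //; exact: measurable_indic.
apply: measurable_funM.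
  apply: measurableT_comp; first exact: measurable_pos_part.
  by apply: measurable_funB => //; exact: measurableT_comp.
apply: measurableT_comp; first exact: measurable_cos.
exact: measurable_funD.
Qed.

Let f_le a c z : `|f a c z| <= \1_`[0, a] z.1 * `|X z.2|.
Proof.
rewrite /f indicE mem_setE in_itv/=; have [/andP[z0 _]|_] := boolP (_ && _).
  rewrite !mul1r normrM -[leRHS]mulr1 ler_pM//; first exact: pos_part_sub_le.
  exact: norm_cos_le1.
by rewrite !mul0r normr0.
Qed.

Let iind a : lebesgue_measure.-integrable setT
  (EFin \o \1_`[0, a] : measurableTypeR R -> \bar R).
Proof. exact: integrable_indic_itv. Qed.

Let if_ a c : (lebesgue_measure \x P)%E.-integrable setT (EFin \o f a c).
Proof.
apply: (le_integrableR measurableT (mf a c) (fun z _ => f_le a c z)).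
exact: (integrable_prodM (iind a) (integrable_norm iX)).
Qed.

Let fE a c u : (\int[P]_s (f a c (u, s))%:E)%E =
  (((fun u => mean_pos_part u * cos (u + c)) \_ `[0, a]) u)%:E.
Proof.
under eq_integral do rewrite /f/= mulrCA EFinM.
rewrite integralZr//; last exact: integrable_pos_part_sub.
rewrite -[X in (X * _)%E]fineK; last exact/integrable_fin_num/integrable_pos_part_sub.
rewrite -EFinM patchE indicE mem_setE; congr EFin.
by case: ifP => _; rewrite ?mul1r// mul0r mulr0.
Qed.

Lemma integrable_mean_pos_part_cos (a c : R) :
  lebesgue_measure.-integrable `[0, a]
    (EFin \o (fun u => mean_pos_part u * cos (u + c))).
Proof.
apply/(integrable_mkcond _ _).2 => //.
have := integrable_fubini_F (if_ a c).
apply: eq_integrable => // u _; rewrite /fubini_F fE /= !patchE.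
by case: ifP.
Qed.

(** Fubini puts the integral over [u] inside the expectation, where at each fixed [s] it has the
    closed form [stop_loss]. *)
Lemma Rintegral_mean_pos_part_cos (a c : R) : 0 <= a ->
  \int[lebesgue_measure]_(u in `[0, a]) (mean_pos_part u * cos (u + c)) =
  \int[P]_s stop_loss a (X s) c.
Proof.
move=> a0; rewrite Rintegral_mkcond /Rintegral; congr fine.
under eq_integral do rewrite -fE.
rewrite (Fubini (if_ a c)); apply: eq_integral => s _.
rewrite -Rintegral_pos_part_cos// Rintegral_mkcond /Rintegral fineK.
  apply: eq_integral => u _; congr EFin.
  by rewrite patchE /f/= indicE mem_setE; case: ifP; rewrite ?mul1r ?mul0r.
apply: integrable_fin_num => //.
have /(integrable_mkcond _ _).1 := integrable_pos_part_cos a (X s) c.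
by move/(_ (measurable_itv _)); rewrite restrict_EFin.
Qed.

End mean_stop_loss.

(** * Letting the cutoff tend to infinity *)

Section centered_stop_loss.
Context {R : realType} d (Omega : measurableType d) (P : probability Omega R).

Lemma integrable_fun_cst (k : R) : P.-integrable setT (EFin \o (fun=> k)).
Proof. exact: (finite_measure_integrable_cst P k measurableT). Qed.

Lemma measurable_stop_loss (X : Omega -> R) (a c : R) :
  measurable_fun setT X -> measurable_fun setT (fun s => stop_loss a (X s) c).
Proof.
move=> mX; rewrite /stop_loss /stop_loss_primitive.
have mm : measurable_fun setT (fun s => Num.min a (Num.max (X s) 0)).
  apply: (measurable_minr (f := cst a) (g := fun s => Num.max (X s) 0)) => //.
  by apply: (measurable_maxr (f := X) (g := cst 0)).
have mt (t : Omega -> R) : measurable_fun setT t ->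
    measurable_fun setT (fun s => (X s - t s) * sin (t s + c) - cos (t s + c)).
  move=> mt; apply: measurable_funB.
    apply: measurable_funM; first exact: measurable_funB.
    by apply: measurableT_comp; [exact: measurable_sin|exact: measurable_funD].
  by apply: measurableT_comp; [exact: measurable_cos|exact: measurable_funD].
by apply: measurable_funB; apply: mt.
Qed.

Lemma integrable_stop_loss (X : Omega -> R) (a c : R) : 0 <= a ->
  P.-integrable setT (EFin \o X) ->
  P.-integrable setT (EFin \o (fun s => stop_loss a (X s) c)).
Proof.
move=> a0 iX; have mX : measurable_fun setT X.
  exact/measurable_EFinP/(measurable_int P).
apply: (@le_integrableR _ _ _ _ _ _ (fun s => 2 * `|X s| + 2)) => //.
- exact: measurable_stop_loss.
- by move=> s _; exact: stop_loss_bound.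
- exact: (integrableD measurableT (integrableZl measurableT 2 (integrable_norm iX))
    (integrable_fun_cst 2)).
Qed.

Variable X : Omega -> R.
Hypothesis iX : P.-integrable setT (EFin \o X).

Let mX : measurable_fun setT X.
Proof. exact/measurable_EFinP/(measurable_int P). Qed.

Let iNX : P.-integrable setT (EFin \o (fun s => - X s)).
Proof. exact: (integrableN iX). Qed.

(** Dominated convergence is available for sequences, so the limit at [+oo] is tested along an
    arbitrary sequence [u] of cutoffs tending to [+oo]. *)
Lemma cvg_Rintegral_stop_loss (c : R) :
  (\int[P]_s (stop_loss a (X s) c + stop_loss a (- X s) (- c))) @[a --> +oo] -->
  \int[P]_s (cos c - cos (X s + c) - X s * sin c).
Proof.
apply/cvg_pinftyP => u uoo.
(* The domination by [2 * `|X s| + 2] is available for nonnegative [a] only. *)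
have cvg_max : (\int[P]_s (stop_loss (Num.max (u n) 0) (X s) c +
    stop_loss (Num.max (u n) 0) (- X s) (- c))) @[n --> \oo] -->
  \int[P]_s (cos c - cos (X s + c) - X s * sin c).
  have a0 n : 0 <= Num.max (u n) 0 by rewrite le_max lexx orbT.
  apply: (@dominated_Rintegral_cvg _ _ _ _ _ _
    (fun s => (2 * `|X s| + 2) + (2 * `|X s| + 2))).
  - by move=> n; apply: measurable_funD; apply: measurable_stop_loss => //;
      exact: measurableT_comp.
  - apply: measurable_funB; last exact: measurable_funM.
    apply: measurable_funB => //.
    by apply: measurableT_comp; [exact: measurable_cos|exact: measurable_funD].
  (* At fixed [s] the integrand equals its limit as soon as [u n] exceeds [|X s|]. *)
  - move=> s; apply: cvg_near_cst; near=> n.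
    apply: stop_loss_sum; rewrite le_max; apply/orP; left.
    by near: n; move/cvgryPge : uoo; exact.
  - have i2 : P.-integrable setT (EFin \o (fun s => 2 * `|X s| + 2)).
      exact: (integrableD measurableT
        (integrableZl measurableT 2 (integrable_norm iX)) (integrable_fun_cst 2)).
    exact: (integrableD measurableT i2 i2).
  - move=> n s; rewrite (le_trans (ler_normD _ _))// lerD ?stop_loss_bound//.
    by rewrite -[X in 2 * X]normrN stop_loss_bound.
apply: cvg_trans cvg_max; apply: near_eq_cvg; near=> n.
suff -> : Num.max (u n) 0 = u n by [].
by apply: max_l; near: n; move/cvgryPge : uoo; exact.
Unshelve. all: by end_near. Qed.

Lemma cvg_partial_integral_mean_pos_part (c : R) :
  \int[P]_s X s = 0 ->
  partial_integral (fun u => mean_pos_part P X u * cos (u + c) +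
    mean_pos_part P (fun s => - X s) u * cos (u - c)) a @[a --> +oo] -->
  cos c - \int[P]_s cos (X s + c).
Proof.
move=> X0.
have icos : P.-integrable setT (EFin \o (fun s => cos (X s + c))).
  apply: (le_integrableR _ _ _ (integrable_fun_cst 1)) => //.
    by apply: measurableT_comp; [exact: measurable_cos|exact: measurable_funD].
  by move=> s _; exact: norm_cos_le1.
(* The linear term [X s * sin c] has mean zero; putting it back gives the limit of the closed
   forms. *)
have -> : cos c - \int[P]_s cos (X s + c) =
    \int[P]_s (cos c - cos (X s + c) - X s * sin c).
  have isin : P.-integrable setT (EFin \o (fun s => X s * sin c)).
    exact: (integrableZr measurableT (sin c) iX).
  have ic := integrable_fun_cst (cos c).
  rewrite RintegralB//; last exact: (integrableB measurableT ic icos).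
  rewrite RintegralB// RintegralZr// X0 mul0r subr0.
  have -> := Rintegral_cst P measurableT (cos c).
  by rewrite (_ : fine _ = 1) ?mulr1//; exact: (congr1 fine (probability_setT P)).
apply: cvg_trans (cvg_Rintegral_stop_loss (c := c)); apply: near_eq_cvg.
near=> a; have a0 : 0 <= a by [].
rewrite /partial_integral [RHS]RintegralD//;
  [|exact: integrable_mean_pos_part_cos..].
by rewrite !Rintegral_mean_pos_part_cos// RintegralD//; exact: integrable_stop_loss.
Unshelve. all: by end_near. Qed.

End centered_stop_loss.

(** * The real part of the Fourier integrand *)

Section wave.
Context {R : realType} (n : nat) (fhat : 'rV[R]_n -> R[i]) (b : 'rV[R]_n -> R).

(** As [f] is real valued, the real part of [expi t * fhat w] is all that its Fourier integral
    requires. *)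
Definition wave (w : 'rV[R]_n) (t : R) : R :=
  cos t * complex.Re (fhat w) - sin t * complex.Im (fhat w).

Lemma Re_expi_mul (w : 'rV[R]_n) (t : R) :
  complex.Re (expi t * fhat w) = wave w t.
Proof. by rewrite /wave /expi; case: (fhat w). Qed.

Hypothesis ifhat : complex_integrable (lebesgue_rV R n) fhat.
Hypothesis fhat_b :
  forall w, fhat w = (Normc.normc (fhat w))%:C * expi (b w).

Local Notation mu := (lebesgue_rV R n).
Local Notation N w := (Normc.normc (fhat w)).

Lemma Re_polar w : complex.Re (fhat w) = N w * cos (b w).
Proof. by rewrite {1}fhat_b /expi /= mul0r subr0. Qed.

Lemma Im_polar w : complex.Im (fhat w) = N w * sin (b w).
Proof. by rewrite {1}fhat_b /expi /= mul0r addr0. Qed.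

Lemma wave_polar w t : wave w t = N w * cos (t + b w).
Proof. by rewrite /wave Re_polar Im_polar cosD; ring. Qed.

Lemma normc_ge0 w : 0 <= N w.
Proof. by case: (fhat w) => x y; exact: sqrtr_ge0. Qed.

Lemma wave_le w t : `|wave w t| <= N w.
Proof.
rewrite wave_polar normrM (ger0_norm (normc_ge0 w)) ler_piMr ?normc_ge0//.
exact: norm_cos_le1.
Qed.

Lemma measurable_Re_fhat : measurable_fun setT (fun w => complex.Re (fhat w)).
Proof. by have [h _] := ifhat; apply/measurable_EFinP; exact: (measurable_int _ h). Qed.

Lemma measurable_Im_fhat : measurable_fun setT (fun w => complex.Im (fhat w)).
Proof. by have [_ h] := ifhat; apply/measurable_EFinP; exact: (measurable_int _ h). Qed.

Lemma measurable_wave d (T : measurableType d) (v : T -> 'rV[R]_n) (t : T -> R) :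
  measurable_fun setT v -> measurable_fun setT t ->
  measurable_fun setT (fun x => wave (v x) (t x)).
Proof.
move=> mv mt; apply: measurable_funB; apply: measurable_funM.
- by apply: measurableT_comp => //; exact: measurable_cos.
- exact: (measurableT_comp measurable_Re_fhat mv).
- by apply: measurableT_comp => //; exact: measurable_sin.
- exact: (measurableT_comp measurable_Im_fhat mv).
Qed.

Lemma measurable_normc : measurable_fun setT (fun w => N w).
Proof.
rewrite [X in measurable_fun _ X](_ : _ =
  fun w => Num.sqrt (complex.Re (fhat w) ^+ 2 + complex.Im (fhat w) ^+ 2)).
  apply: measurableT_comp.
    by apply: continuous_measurable_fun; exact: sqrt_continuous.
  by apply: measurable_funD; apply: measurable_funX;
    [exact: measurable_Re_fhat|exact: measurable_Im_fhat].
by apply/funext => w; case: (fhat w).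
Qed.

(** Integrability is given for the real and imaginary parts; the modulus is at most the sum of their
    absolute values. *)
Lemma integrable_normc : mu.-integrable setT (EFin \o (fun w => N w)).
Proof.
have [iA iB] := ifhat.
apply: (@le_integrableR _ _ _ _ _ _
  (fun w => `|complex.Re (fhat w)| + `|complex.Im (fhat w)|)) => //.
- exact: measurable_normc.
- move=> w _; rewrite (ger0_norm (normc_ge0 w)).
  case: (fhat w) => x y /=.
  (* After squaring, the two sides differ by the nonnegative cross term. *)
  rewrite -(@ler_pXn2r _ 2)// ?nnegrE ?sqrtr_ge0 ?addr_ge0//.
  rewrite sqr_sqrtr ?addr_ge0 ?sqr_ge0// sqrrD !real_normK ?num_real//.
  by rewrite lerD2r lerDl mulrn_wge0// mulr_ge0.
- exact: (integrableD measurableT (integrable_norm iA) (integrable_norm iB)).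
Qed.

End wave.

(** * Inner products, the Taylor bound and the half-line integral *)

Lemma measurable_inner (R : realType) (n : nat) d (T : measurableType d)
    (u v : T -> 'rV[R]_n) : measurable_fun setT u -> measurable_fun setT v ->
  measurable_fun setT (fun x => inner (u x) (v x)).
Proof.
move=> mu mv; rewrite /inner; apply: measurable_sum => i.
by apply: measurable_funM; apply: (measurableT_comp (measurable_rV_coord i)).
Qed.

Lemma innerZr (R : realType) (n : nat) (u v : 'rV[R]_n) (t : R) :
  inner u (t *: v) = t * inner u v.
Proof.
by rewrite /inner big_distrr; apply: eq_bigr => i _; rewrite mxE mulrCA.
Qed.

Lemma inner0r (R : realType) (n : nat) (u : 'rV[R]_n) : inner u 0 = 0.
Proof. by rewrite /inner big1// => i _; rewrite mxE mulr0. Qed.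

(** With [y = |t|], the quadratic branch follows from [y - y^2 / 2 <= 1 / 2]; the constant 4 leaves
    room. Against an integrable [fhat], the Taylor condition thus controls the first moment. *)
Lemma norm_le_taylor_bound (R : realType) (t : R) : `|t| <= 4 + taylor_bound t.
Proof.
rewrite /taylor_bound; have t0 := normr_ge0 t; move: `|t| t0 => y y0.
rewrite -lerBlDl le_min; apply/andP; split; nra.
Qed.

Lemma taylor_bound_ge0 (R : realType) (t : R) : 0 <= taylor_bound t.
Proof. by rewrite /taylor_bound le_min mulr_ge0//= divr_ge0// exprn_ge0. Qed.

Lemma measurable_taylor_bound (R : realType) :
  measurable_fun setT (@taylor_bound R).
Proof.
rewrite /taylor_bound.
apply: (measurable_minr (f := fun t : R => 2 * `|t|)
  (g := fun t : R => `|t| ^+ 2 / 2)).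
  by apply: measurable_funM => //; exact: normr_measurable.
by apply: measurable_funM => //; apply: measurable_funX; exact: normr_measurable.
Qed.

(** Both positive parts vanish for [u] past [|t|], so the half line reduces to [[0, |t|]] and
    [stop_loss_sum] applies with cutoff [|t|]. The 2 dividing [N] comes from [sign_avg]. *)
Lemma Rintegral_half_line_stop_loss (R : realType) (t c N : R) :
  \int[lebesgue_measure]_(u in `[0, +oo[)
    (sign_avg (fun e : R => pos_part (e * t - u) * cos (u + e * c)) * N) =
  (cos c - cos (t + c) - t * sin c) * (N / 2).
Proof.
rewrite -(stop_loss_sum c (lexx `|t|)) -!Rintegral_pos_part_cos//.
rewrite -RintegralD//; [|exact: integrable_pos_part_cos..].
rewrite -RintegralZr//; last first.
  exact: (integrableD _ (integrable_pos_part_cos _ _ _) (integrable_pos_part_cos _ _ _)).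
rewrite Rintegral_mkcond [RHS]Rintegral_mkcond; congr Rintegral.
apply/funext => u; rewrite !patchE !mem_setE !in_itv/= andbT /sign_avg.
have [u0/=|//] := leP 0 u; rewrite !mul1r !mulN1r.
have [ut|tu] := leP u `|t|; first by field.
have p0 x : x <= `|t| -> pos_part (x - u) = 0.
  by move=> xt; rewrite /pos_part max_r// subr_le0 ltW// (le_lt_trans xt).
have nt : - t <= `|t| by rewrite -normrN ler_norm.
by rewrite !p0 ?ler_norm// !mul0r addr0 !mul0r.
Qed.

(** * The representation at a fixed point *)

Section ridge_representation.
Context {R : realType} (n : nat) (f : 'rV[R]_n -> R)
  (fhat : 'rV[R]_n -> R[i]) (b : 'rV[R]_n -> R).
Hypothesis f_fhat : fourier_repr f fhat.
Hypothesis fhat_b :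
  forall w, fhat w = (Normc.normc (fhat w))%:C * expi (b w).

Local Notation mu := (lebesgue_rV R n).
Local Notation N w := (Normc.normc (fhat w)).

Let ifhat : complex_integrable mu fhat := f_fhat.1.

Lemma fourier_repr_wave x : f x = \int[mu]_w wave fhat w (inner w x).
Proof.
have [_ /(_ x)] := f_fhat; rewrite /complex_integral => -[-> _].
by apply: eq_Rintegral => w _; rewrite Re_expi_mul.
Qed.

Variable x : 'rV[R]_n.
Hypothesis taylor_x :
  (\int[mu]_w (taylor_bound (inner w x) * N w)%:E < +oo)%E.

Let minner : measurable_fun setT (fun w : 'rV[R]_n => inner w x).
Proof. exact: (@measurable_inner _ _ _ _ id (cst x)). Qed.

(** This function dominates the derivative of the Fourier integrand along the line through [x]. *)
Lemma integrable_inner_normc :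
  mu.-integrable setT (EFin \o (fun w => `|inner w x| * N w)).
Proof.
have mN := measurable_normc ifhat.
have iT : mu.-integrable setT (EFin \o (fun w => taylor_bound (inner w x) * N w)).
  apply/integrableP; split.
    apply/measurable_EFinP/measurable_funM => //.
    exact: (measurableT_comp (@measurable_taylor_bound R) minner).
  rewrite (eq_integral (fun w => (taylor_bound (inner w x) * N w)%:E))//.
  move=> w _ /=; rewrite ger0_norm// mulr_ge0 ?taylor_bound_ge0 ?normc_ge0//.
apply: (@le_integrableR _ _ _ _ _ _
  (fun w => 4 * N w + taylor_bound (inner w x) * N w)) => //.
- by apply: measurable_funM => //; exact: measurableT_comp.
- move=> w _; rewrite ger0_norm ?mulr_ge0 ?normc_ge0// -mulrDl.
  by rewrite ler_wpM2r ?normc_ge0// norm_le_taylor_bound.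
- exact: (integrableD measurableT (integrableZl measurableT 4
    (integrable_normc ifhat)) iT).
Qed.

Let integrable_wave v : measurable_fun setT v ->
  mu.-integrable setT (EFin \o (fun w => wave fhat w (v w))).
Proof.
move=> mv; apply: (le_integrableR _ _ _ (integrable_normc ifhat)) => //.
- exact: (measurable_wave (v := id) ifhat _ mv).
- by move=> w _; exact: wave_le.
Qed.

Let wave_line (t : R) w := wave fhat w (t * inner w x).

Let dwave_line (t : R) w : is_derive t 1 (wave_line ^~ w)
  (- (inner w x * (N w * sin (t * inner w x + b w)))).
Proof.
rewrite /wave_line /wave; apply: is_derive_eq.
rewrite (Re_polar fhat_b) (Im_polar fhat_b) sinD /GRing.scale/=; ring.
Qed.

Let f_lineE : (fun t : R => f (t *: x)) = fun t => \int[mu]_w wave_line t w.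
Proof.
apply/funext => t; rewrite fourier_repr_wave.
by apply: eq_Rintegral => w _; rewrite /wave_line innerZr.
Qed.

Let d1_wave_line t w : partial1of2 wave_line t w =
  - (inner w x * (N w * sin (t * inner w x + b w))).
Proof. by rewrite partial1of2E; exact: derive_val. Qed.

(** Differentiation under the integral sign takes place on an open interval around 0; as the
    domination is uniform in [t], the radius 1 is arbitrary. *)
Let I : set R := `](-1), 1[.

Let I0 : I 0.
Proof. by rewrite /I /= in_itv/= ltrN10 ltr01. Qed.

Let iwave_line t : I t -> mu.-integrable setT (EFin \o wave_line t).
Proof. by move=> _; apply: integrable_wave; exact: measurable_funM. Qed.

Let d1_wave_line_ub t w : I t -> setT w ->
  `|partial1of2 wave_line t w| <= `|inner w x| * N w.
Proof.
move=> _ _; rewrite d1_wave_line normrN normrM ler_wpM2l// normrM.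
rewrite (ger0_norm (normc_ge0 _ _)) ler_piMr ?normc_ge0//.
exact: norm_sin_le1.
Qed.

Let inner_normc_ge0 w : 0 <= `|inner w x| * N w.
Proof. by rewrite mulr_ge0 ?normc_ge0. Qed.

Let wave_line_derivable (t : R) w : I t -> setT w ->
  derivable (wave_line ^~ w) t 1.
Proof. by move=> _ _; exact: ex_derive. Qed.

Lemma derivable_fourier_line : derivable (fun t : R => f (t *: x)) 0 1.
Proof.
rewrite f_lineE; exact: (derivable_under_integral measurableT I0 iwave_line
  wave_line_derivable inner_normc_ge0 integrable_inner_normc d1_wave_line_ub).
Qed.

Lemma derive1_fourier_line : derive1 (fun t : R => f (t *: x)) 0 =
  \int[mu]_w (- (inner w x * (N w * sin (b w)))).
Proof.
rewrite f_lineE (differentiation_under_integral measurableT I0 iwave_line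
  wave_line_derivable inner_normc_ge0 integrable_inner_normc d1_wave_line_ub).
by apply: eq_Rintegral => w _; rewrite d1_wave_line mul0r add0r.
Qed.

Let idrift :
  mu.-integrable setT (EFin \o (fun w => - (inner w x * (N w * sin (b w))))).
Proof.
apply: (le_integrableR _ _ _ integrable_inner_normc) => //.
- apply: measurableT_comp => //; apply: measurable_funM => //.
  (* The phase [b] is not known to be measurable, but [N w * sin (b w)] is the imaginary part of
     [fhat w]. *)
  rewrite [X in measurable_fun _ X](_ : _ = fun w => complex.Im (fhat w)).
    exact: measurable_Im_fhat ifhat.
  by apply/funext => w; rewrite (Im_polar fhat_b).
- move=> w _; rewrite normrN !normrM (ger0_norm (normc_ge0 _ _)).
  rewrite ler_wpM2l// ler_piMr ?normc_ge0//.
  exact: norm_sin_le1.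
Qed.

Let inner_integral w := \int[lebesgue_measure]_(u in `[0, +oo[)
  (sign_avg (fun e : R => pos_part (e * inner w x - u) * cos (u + e * b w)) *
   N w).

(** Integrated over [w], the three terms give [f 0], [f x] and the derivative at 0. The factor
    [2^-1] is undone by the 2 in the representation. *)
Let inner_integralE : inner_integral = fun w => 2^-1 *
  (wave fhat w 0 - wave fhat w (inner w x) + - (inner w x * (N w * sin (b w)))).
Proof.
apply/funext => w; rewrite /inner_integral Rintegral_half_line_stop_loss.
by rewrite !(wave_polar fhat_b) add0r; field.
Qed.

Let iwave0 : mu.-integrable setT (EFin \o (fun w => wave fhat w 0)).
Proof. by apply: integrable_wave; exact: measurable_cst. Qed.

Let iwavex : mu.-integrable setT (EFin \o (fun w => wave fhat w (inner w x))).
Proof. exact: integrable_wave. Qed.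

Let isum : mu.-integrable setT (EFin \o (fun w =>
  wave fhat w 0 - wave fhat w (inner w x) + - (inner w x * (N w * sin (b w))))).
Proof.
exact: (integrableD measurableT (integrableB measurableT iwave0 iwavex) idrift).
Qed.

Lemma ridge_representation :
  [/\ derivable (fun t : R => f (t *: x)) 0 1,
      mu.-integrable setT (fun w => (inner_integral w)%:E) &
      f x = f 0 + derive1 (fun t : R => f (t *: x)) 0 -
            2 * \int[mu]_w inner_integral w].
Proof.
rewrite inner_integralE; split; first exact: derivable_fourier_line.
  exact: (integrableZl measurableT 2^-1 isum).
rewrite RintegralZl// RintegralD//; last first.
  exact: (integrableB measurableT iwave0 iwavex).
rewrite RintegralB// derive1_fourier_line (fourier_repr_wave x) (fourier_repr_wave 0).
rewrite (_ : \int[mu]_w wave fhat w (inner w 0) = \int[mu]_w wave fhat w 0).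
  by field.
by apply: eq_Rintegral => w _; rewrite inner0r.
Qed.

End ridge_representation.

(** * Linear forms of random vectors and the stop-loss gap *)

Section random_ridge.
Context {R : realType} (n : nat) d (Omega : measurableType d)
  (P : probability Omega R).
Implicit Types V W : Omega -> 'rV[R]_n.

Lemma integrable_inner V (w : 'rV[R]_n) : centered P V ->
  P.-integrable setT (EFin \o (fun s => inner w (V s))).
Proof.
move=> cV; rewrite [X in P.-integrable _ X](_ : _ =
    fun s => (\sum_(i < n) ((w ord0 i)%:E * (V s ord0 i)%:E))%E); last first.
  by apply/funext => s; rewrite /= /inner -sumEFin.
apply: integrable_sum => // i _.
by apply: integrableZl => //; have [] := cV i.
Qed.

Lemma centered_Rintegral_inner V (w : 'rV[R]_n) : centered P V ->
  \int[P]_s inner w (V s) = 0.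
Proof.
move=> cV; rewrite /Rintegral (eq_integral
    (fun s => \sum_(i < n) ((w ord0 i)%:E * (V s ord0 i)%:E))%E); last first.
  by move=> s _; rewrite /inner -sumEFin.
rewrite integral_sum//.
  rewrite big1// => i _; have [iV] := cV i.
  by rewrite unlock integralZl// => ->; rewrite mule0.
by move=> i; apply: integrableZl => //; have [] := cV i.
Qed.

Lemma ridge_gapE V W (w : 'rV[R]_n) (e u : R) : centered P V -> centered P W ->
  ridge_gap P V W w e u = mean_pos_part P (fun s => e * inner w (V s)) u -
                          mean_pos_part P (fun s => e * inner w (W s)) u.
Proof.
move=> cV cW; have i U : centered P U ->
    P.-integrable setT (EFin \o (fun s => pos_part (e * inner w (U s) - u))).
  move=> cU; apply: integrable_pos_part_sub.
  exact: (integrableZl measurableT e (integrable_inner w cU)).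
rewrite /ridge_gap unlock; exact: (RintegralB measurableT (i _ cV) (i _ cW)).
Qed.

(** Joint measurability in [(w, u)] is what the iterated integrals of the upper bound require. *)
Lemma measurable_ridge_gap V W (e : R) :
  measurable_fun setT V -> measurable_fun setT W ->
  measurable_fun setT
    (fun z : 'rV[R]_n * measurableTypeR R => ridge_gap P V W z.1 e z.2).
Proof.
move=> mV mW; rewrite /ridge_gap; apply: measurableT_comp; first exact: fine_measurable.
under eq_fun do rewrite unlock.
have m U : measurable_fun setT U -> measurable_fun setT
    (fun y : ('rV[R]_n * measurableTypeR R) * Omega =>
      pos_part (e * inner y.1.1 (U y.2) - y.1.2)).
  move=> mU; apply: measurableT_comp; first exact: measurable_pos_part.
  apply: measurable_funB; last exact: measurableT_comp.
  apply: measurable_funM => //; apply: measurable_inner.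
    exact: measurableT_comp.
  exact: measurableT_comp.
have := @measurable_fun_integral2 _ _ _ _ _ P
  (fun y : ('rV[R]_n * measurableTypeR R) * Omega =>
  (pos_part (e * inner y.1.1 (V y.2) - y.1.2) -
   pos_part (e * inner y.1.1 (W y.2) - y.1.2))%:E); apply.
by apply/measurable_EFinP/measurable_funB; exact: m.
Qed.

(** * The Fourier formula for expectations of [f] *)

Context (f : 'rV[R]_n -> R) (fhat : 'rV[R]_n -> R[i]) (b : 'rV[R]_n -> R).
Hypothesis f_fhat : fourier_repr f fhat.
Hypothesis fhat_b :
  forall w, fhat w = (Normc.normc (fhat w))%:C * expi (b w).

Local Notation mu := (lebesgue_rV R n).
Local Notation N w := (Normc.normc (fhat w)).

Let ifhat : complex_integrable mu fhat := f_fhat.1.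

(** For measurable [V] this is the real part of [fhat w] times the characteristic function of [V] at
    [w]. *)
Definition mean_wave V (w : 'rV[R]_n) : R := \int[P]_s wave fhat w (inner w (V s)).

Let integrable_prod_wave V : measurable_fun setT V ->
  (mu \x P)%E.-integrable setT (fun z => (wave fhat z.1 (inner z.1 (V z.2)))%:E).
Proof.
move=> mV; have := integrable_prodM (integrable_normc ifhat) (integrable_fun_cst P 1).
apply: le_integrableR => //.
- apply: (measurable_wave ifhat) => //.
  by apply: measurable_inner => //; exact: measurableT_comp.
- by move=> z _; rewrite mulr1; exact: wave_le.
Qed.

Let integrable_wave V (w : 'rV[R]_n) : measurable_fun setT V ->
  P.-integrable setT (EFin \o (fun s => wave fhat w (inner w (V s)))).
Proof.
move=> mV; apply: (le_integrableR _ _ _ (integrable_fun_cst P (N w))) => //.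
- apply: (measurable_wave (v := cst w) ifhat) => //.
  exact: (measurable_inner (u := cst w)).
- by move=> s _; exact: wave_le.
Qed.

Let mean_waveE V w : measurable_fun setT V ->
  (\int[P]_s (wave fhat w (inner w (V s)))%:E)%E = (mean_wave V w)%:E.
Proof.
move=> mV; rewrite /mean_wave /Rintegral fineK//.
exact/integrable_fin_num/integrable_wave.
Qed.

Lemma integrable_mean_wave V : measurable_fun setT V ->
  mu.-integrable setT (EFin \o mean_wave V).
Proof.
move=> mV; have := integrable_fubini_F (integrable_prod_wave mV).
apply: eq_integrable => // w _; exact: mean_waveE.
Qed.

(** Fubini applies because the wave is dominated by the modulus of [fhat w], integrable against the
    product with a probability. *)
Lemma expectation_fourier V : measurable_fun setT V ->
  fine ('E_P[f \o V])%E = \int[mu]_w mean_wave V w.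
Proof.
move=> mV; rewrite unlock /Rintegral; congr fine.
under [RHS]eq_integral do rewrite -mean_waveE//.
rewrite (Fubini (integrable_prod_wave mV)); apply: eq_integral => s _ /=.
rewrite (fourier_repr_wave f_fhat) /Rintegral fineK//; apply: integrable_fin_num => //.
apply: (le_integrableR _ _ _ (integrable_normc ifhat)) => //.
- apply: (measurable_wave (v := id) ifhat) => //.
  exact: (measurable_inner (u := id) (v := cst (V s))).
- by move=> w _; exact: wave_le.
Qed.

Lemma Delta_mean_wave V W : measurable_fun setT V -> measurable_fun setT W ->
  Delta P f V W = `|\int[mu]_w mean_wave V w - \int[mu]_w mean_wave W w|.
Proof. by move=> mV mW; rewrite /Delta !expectation_fourier. Qed.

(** * The exact formula for two centered random vectors *)

Variables W Wn : Omega -> 'rV[R]_n.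
Hypotheses (mW : measurable_fun setT W) (mWn : measurable_fun setT Wn).
Hypotheses (cW : centered P W) (cWn : centered P Wn).

Let integrand w u :=
  sign_avg (fun e : R => ridge_gap P Wn W w e u * cos (u + e * b w)) * N w.

(** The contributions of both signs are grouped for a single vector, because the limit in the cutoff
    exists for the sum over the pairs [(t, b w)] and [(- t, - b w)]. *)
Let mean_sum V w u :=
  mean_pos_part P (fun s => inner w (V s)) u * cos (u + b w) +
  mean_pos_part P (fun s => - inner w (V s)) u * cos (u - b w).

Let integrandE w u : integrand w u = (mean_sum Wn w u - mean_sum W w u) * (N w / 2).
Proof.
rewrite /integrand /sign_avg !ridge_gapE// /mean_sum !mul1r !mulN1r.
have E V : (fun s => 1 * inner w (V s)) = (fun s => inner w (V s)).
  by apply/funext => s; rewrite mul1r.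
have EN V : (fun s => -1 * inner w (V s)) = (fun s => - inner w (V s)).
  by apply/funext => s; rewrite mulN1r.
by rewrite !E !EN; field.
Qed.

Let integrable_mean_sum V w a : centered P V ->
  lebesgue_measure.-integrable `[0, a] (EFin \o mean_sum V w).
Proof.
move=> cV; have iV := integrable_inner w cV.
exact: (integrableD _ (integrable_mean_pos_part_cos iV a (b w))
  (integrable_mean_pos_part_cos (integrableN iV) a (- b w))).
Qed.

Let integrable_integrand w a :
  lebesgue_measure.-integrable `[0, a] (EFin \o integrand w).
Proof.
rewrite (_ : integrand w = fun u => (N w / 2) * (mean_sum Wn w u - mean_sum W w u)).
  have mI : measurable (`[0, a]%classic : set (measurableTypeR R)) by [].
  exact: (integrableZl mI (N w / 2) (integrableB mI
    (integrable_mean_sum w a cWn) (integrable_mean_sum w a cW))).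
by apply/funext => u; rewrite mulrC integrandE.
Qed.

Let partial_integral_integrand w a : partial_integral (integrand w) a =
  (partial_integral (mean_sum Wn w) a - partial_integral (mean_sum W w) a) *
  (N w / 2).
Proof.
have mI : measurable (`[0, a]%classic : set (measurableTypeR R)) by [].
rewrite /partial_integral -RintegralB//; [|exact: integrable_mean_sum..].
rewrite -RintegralZr//.
  by apply: eq_Rintegral => u _; exact: integrandE.
exact: (integrableB mI (integrable_mean_sum w a cWn) (integrable_mean_sum w a cW)).
Qed.

Let mean_wave_polar V w : measurable_fun setT V ->
  mean_wave V w = N w * \int[P]_s cos (inner w (V s) + b w).
Proof.
move=> mV; rewrite /mean_wave -RintegralZl//.
  by apply: eq_Rintegral => s _; exact: wave_polar.
apply: (le_integrableR _ _ _ (integrable_fun_cst P 1)) => //.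
  apply: measurableT_comp; first exact: measurable_cos.
  by apply: measurable_funD => //; exact: (measurable_inner (u := cst w)).
by move=> s _; exact: norm_cos_le1.
Qed.

Lemma cvg_partial_integral_integrand w :
  partial_integral (integrand w) a @[a --> +oo] -->
  2^-1 * (mean_wave W w - mean_wave Wn w).
Proof.
under eq_fun do rewrite partial_integral_integrand.
have c V : centered P V -> partial_integral (mean_sum V w) a @[a --> +oo] -->
    cos (b w) - \int[P]_s cos (inner w (V s) + b w).
  move=> cV; apply: cvg_partial_integral_mean_pos_part.
    exact: integrable_inner.
  exact: centered_Rintegral_inner.
(* The terms [cos (b w)] of the two limits cancel. The minus sign in front of each expectation is
   why [W] comes before [Wn] in the limit. *)
rewrite !mean_wave_polar// (_ : 2^-1 * _ =
  ((cos (b w) - \int[P]_s cos (inner w (Wn s) + b w)) -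
   (cos (b w) - \int[P]_s cos (inner w (W s) + b w))) * (N w / 2)); last by field.
by apply: cvgMl; apply: cvgB; exact: c.
Qed.

Lemma improper_integral_integrand w : improper_integral (integrand w) =
  2^-1 * (mean_wave W w - mean_wave Wn w).
Proof. exact/cvg_lim/cvg_partial_integral_integrand. Qed.

(** Each improper integral is half a difference of mean waves, and these are integrable in [w] by
    Fubini. *)
Lemma integrable_improper_integral :
  mu.-integrable setT (fun w => (improper_integral (integrand w))%:E).
Proof.
under eq_fun do rewrite improper_integral_integrand.
exact: (integrableZl measurableT 2^-1 (integrableB measurableT
  (integrable_mean_wave mW) (integrable_mean_wave mWn))).
Qed.

Lemma Delta_improper_integral : Delta P f W Wn =
  `|2 * \int[mu]_w improper_integral (integrand w)|.
Proof.
rewrite Delta_mean_wave//; congr (Num.norm _).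
under [X in 2 * X]eq_Rintegral do rewrite improper_integral_integrand.
rewrite RintegralZl//; last first.
  exact: (integrableB measurableT (integrable_mean_wave mW) (integrable_mean_wave mWn)).
by rewrite mulVKf// RintegralB//; exact: integrable_mean_wave.
Qed.



(** * The upper bound by absolute stop-loss gaps *)

Let ridge_mass (e : R) (w : 'rV[R]_n) : \bar R :=
  (\int[lebesgue_measure]_(u in `[0%R, +oo[)
    (`|ridge_gap P Wn W w e u| * N w)%:E)%E.

Let measurable_ridge_mass_integrand (e : R) : measurable_fun setT
  (fun z : 'rV[R]_n * measurableTypeR R => `|ridge_gap P Wn W z.1 e z.2| * N z.1).
Proof.
apply: measurable_funM.
  apply: measurableT_comp; first exact: normr_measurable.
  exact: measurable_ridge_gap.
exact: (measurableT_comp (measurable_normc ifhat)).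
Qed.

Let measurable_ridge_mass_section (e : R) (w : 'rV[R]_n) :
  measurable_fun setT (fun u : measurableTypeR R => `|ridge_gap P Wn W w e u| * N w).
Proof.
exact: (measurableT_comp (measurable_ridge_mass_integrand e) (measurable_pair1 w)).
Qed.

Let ridge_mass_integrand_ge0 e w u : 0 <= `|ridge_gap P Wn W w e u| * N w.
Proof. by rewrite mulr_ge0 ?normc_ge0. Qed.

Let ridge_mass_ge0 e w : (0 <= ridge_mass e w)%E.
Proof. by apply: integral_ge0 => u _; rewrite lee_fin. Qed.

Let measurable_ridge_mass e : measurable_fun setT (ridge_mass e).
Proof.
(* Moving the half line into an indicator gives a nonnegative function on the product space, to
   which Tonelli applies. *)
pose g (z : 'rV[R]_n * measurableTypeR R) : \bar R :=
  (`|ridge_gap P Wn W z.1 e z.2| * N z.1 * \1_`[0, +oo[ z.2)%:E.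
have mg : measurable_fun setT g.
  apply/measurable_EFinP/measurable_funM; first exact: measurable_ridge_mass_integrand.
  by apply: measurableT_comp => //; exact: measurable_indic.
have -> : ridge_mass e = fubini_F lebesgue_measure g.
  apply/funext => w; rewrite /ridge_mass integral_mkcond; apply: eq_integral => u _.
  by rewrite /g patchE/= indicE; case: ifP; rewrite ?mulr1// mulr0.
apply: measurable_fun_fubini_tonelli_F => // z.
by rewrite lee_fin mulr_ge0.
Qed.

(** The factor 2 cancels the half in [sign_avg], leaving a plain sum over the two signs with each
    cosine bounded by 1. *)
Let integrand_le w u : `|2 * integrand w u| <=
  `|ridge_gap P Wn W w 1 u| * N w + `|ridge_gap P Wn W w (-1) u| * N w.
Proof.
have c (g t : R) : `|g * cos t| <= `|g|.
  by rewrite normrM ler_piMr// norm_cos_le1.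
rewrite /integrand /sign_avg mulrA (mulrC 2) divfK// normrM -mulrDl.
rewrite (ger0_norm (normc_ge0 _ _)) ler_wpM2r ?normc_ge0//.
by rewrite (le_trans (ler_normD _ _))// lerD.
Qed.

(** Each partial integral is bounded by enlarging [[0, a]] to the half line after taking absolute
    values; the bound does not depend on [a] and passes to the limit. *)
Lemma improper_integral_le w :
  (`|2 * improper_integral (integrand w)|%:E <= ridge_mass 1 w + ridge_mass (-1) w)%E.
Proof.
have : (0 <= ridge_mass 1 w + ridge_mass (-1) w)%E by rewrite adde_ge0.
have mI a : measurable (`[0, a]%classic : set (measurableTypeR R)) by [].
have partial_le a : (`|2 * partial_integral (integrand w) a|%:E <=
    ridge_mass 1 w + ridge_mass (-1) w)%E.
  have i2 : lebesgue_measure.-integrable `[0, a] (EFin \o (fun u => 2 * integrand w u)).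
    exact: (integrableZl (mI a) 2 (integrable_integrand w a)).
  rewrite /partial_integral -RintegralZl// EFin_normr_Rintegral//.
  apply: (le_trans (le_abse_integral _ _ (measurable_int _ i2))) => //.
  rewrite /ridge_mass -ge0_integralD//.
  - apply: (@le_trans _ _ (\int[lebesgue_measure]_(u in `[0%R, a])
      ((`|ridge_gap P Wn W w 1 u| * N w)%:E +
       (`|ridge_gap P Wn W w (-1) u| * N w)%:E))%E).
      apply: ge0_le_integral => //.
      + by apply: measurableT_comp => //; exact: measurable_int i2.
      + by apply: emeasurable_funD; apply/measurable_EFinP/measurable_funTS;
          exact: measurable_ridge_mass_section.
      + by move=> u _; rewrite lee_fin; exact: integrand_le.
    apply: ge0_subset_integral => //.
    + by apply: emeasurable_funD; apply/measurable_EFinP/measurable_funTS;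
          exact: measurable_ridge_mass_section.
    + by move=> u _; rewrite adde_ge0// lee_fin.
    + by move=> u /=; rewrite !in_itv/= andbT => /andP[].
  - by move=> u _; rewrite lee_fin.
  - by apply/measurable_EFinP/measurable_funTS; exact: measurable_ridge_mass_section.
  - by move=> u _; rewrite lee_fin.
  - by apply/measurable_EFinP/measurable_funTS; exact: measurable_ridge_mass_section.
(* The right-hand side may be [+oo], where the bound is trivial; [-oo] is excluded by nonnegativity.
   The limit is taken in the finite case. *)
move: (_ + _)%E partial_le => [r partial_le _|_ _|_ //]; last by rewrite leey.
rewrite lee_fin improper_integral_integrand.
have cv : `|2 * partial_integral (integrand w) a| @[a --> +oo] -->
    `|2 * (2^-1 * (mean_wave W w - mean_wave Wn w))|.
  have cv2 : 2 * partial_integral (integrand w) a @[a --> +oo] -->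
      2 * (2^-1 * (mean_wave W w - mean_wave Wn w)).
    apply: cvgM; first exact: cvg_cst.
    exact: cvg_partial_integral_integrand.
  exact: (cvg_norm cv2).
apply: (cvgr_to_le cv).
by near=> a; rewrite -lee_fin.
Unshelve. all: by end_near. Qed.

(** The absolute value enters the integral over [w], and the pointwise bound is then integrated;
    nonnegativity splits the resulting integral between the two signs. *)
Lemma Delta_le_ridge_mass : ((Delta P f W Wn)%:E <= 2%:E *
  sign_avge (fun e : R => \int[mu]_w ridge_mass e w))%E.
Proof.
have -> : (2%:E * sign_avge (fun e : R => \int[mu]_w ridge_mass e w) =
    \int[mu]_w (ridge_mass 1 w + ridge_mass (-1) w))%E.
  by rewrite /sign_avge muleCA -EFinM divff// mule1 [RHS]ge0_integralD//.
have i2 : mu.-integrable setT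
    (EFin \o (fun w => 2 * improper_integral (integrand w))).
  exact: (integrableZl measurableT 2 integrable_improper_integral).
rewrite Delta_improper_integral -RintegralZl//; last first.
  exact: integrable_improper_integral.
rewrite EFin_normr_Rintegral//.
apply: (le_trans (le_abse_integral _ _ (measurable_int _ i2))) => //.
apply: ge0_le_integral => //.
- by apply: measurableT_comp => //; exact: measurable_int i2.
- exact: (emeasurable_funD (measurable_ridge_mass 1) (measurable_ridge_mass (-1))).
- by move=> w _; exact: improper_integral_le.
Qed.

End random_ridge.

Theorem theorem3p1 (R : realType) (n : nat)
  (f : 'rV[R]_n -> R) (fhat : 'rV[R]_n -> R[i]) (b : 'rV[R]_n -> R)
  (f_fhat : fourier_repr f fhat)
  (fhat_b : forall w, fhat w = (Normc.normc (fhat w))%:C * expi (b w)) :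
  (forall x : 'rV[R]_n,
    (\int[lebesgue_rV R n]_w
      (taylor_bound (inner w x) * Normc.normc (fhat w))%:E < +oo)%E ->
    let inner_integral w := \int[lebesgue_measure]_(u in `[0, +oo[)
      (sign_avg (fun e : R => pos_part (e * inner w x - u) * cos (u + e * b w)) *
       Normc.normc (fhat w)) in
    [/\ derivable (fun t : R => f (t *: x)) 0 1,
        (lebesgue_rV R n).-integrable setT (fun w => (inner_integral w)%:E) &
        f x = f 0 + derive1 (fun t : R => f (t *: x)) 0 -
              2 * \int[lebesgue_rV R n]_w inner_integral w])
  /\
  (forall (dO : measure_display) (Omega : measurableType dO)
     (P : probability Omega R) (W Wn : {RV P >-> 'rV[R]_n}),
    centered P W -> centered P Wn ->
    (\int[lebesgue_rV R n]_w
      ('E_P[fun s => taylor_bound (inner w (Wn s))] *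
       (Normc.normc (fhat w))%:E) < +oo)%E ->
    (\int[lebesgue_rV R n]_w
      ('E_P[fun s => taylor_bound (inner w (W s))] *
       (Normc.normc (fhat w))%:E) < +oo)%E ->
    let integrand w u :=
      sign_avg (fun e : R => ridge_gap P Wn W w e u * cos (u + e * b w)) *
      Normc.normc (fhat w) in
    [/\ (forall w, cvg (partial_integral (integrand w) a @[a --> +oo])),
        (lebesgue_rV R n).-integrable setT
          (fun w => (improper_integral (integrand w))%:E),
        Delta P f W Wn =
          `|2 * \int[lebesgue_rV R n]_w improper_integral (integrand w)| &
        ((Delta P f W Wn)%:E <=
          2%:E * sign_avge (fun e : R => \int[lebesgue_rV R n]_w
            \int[lebesgue_measure]_(u in `[0%R, +oo[)
              (`|ridge_gap P Wn W w e u| * Normc.normc (fhat w))%:E))%E]).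
Proof.
split=> [x taylor_x /=|dO Omega P W Wn cW cWn _ _ /=].
  exact: ridge_representation f_fhat fhat_b x taylor_x.
have mW : measurable_fun setT W by exact: measurable_funPT.
have mWn : measurable_fun setT Wn by exact: measurable_funPT.
split.
- move=> w; apply/cvg_ex; eexists.
  exact: (cvg_partial_integral_integrand fhat_b mW mWn cW cWn).
- exact: (integrable_improper_integral f_fhat fhat_b mW mWn cW cWn).
- exact: (Delta_improper_integral f_fhat fhat_b mW mWn cW cWn).
- exact: (Delta_le_ridge_mass f_fhat fhat_b mW mWn cW cWn).
Qed.
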